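(* Let $(X,d)$ be a nonempty ultrametric space and let $D(X)$ be the distance set of $(X,d)$. Then the following conditions are equivalent: (i) The space $(X,d)$ is bounded and $\operatorname{diam}(X,d)\notin D(X)$. (ii) There is $a\in(0,\infty)$ such that the set $[a,\infty)$ is a connected component of $\mathbb{R}^{+}\setminus D(X)$. (iii) There is $(Z,\delta)\in WS(X,d)$ such that for every weak similarity $\Phi\colon Z\to X$ of $(Z,\delta)$ and $(X,d)$ with scaling function $\psi\colon D(X)\to D(Z)$, and for every pseudoultrametric preserving function $g\colon\mathbb{R}^{+}\to\mathbb{R}^{+}$, one has $g|_{D(X)}\neq\psi$.
   Context: $\mathbb{R}^{+}=[0,\infty)$. An ultrametric on a set $X$ is a metric $d\colon X\times X\to\mathbb{R}^{+}$ satisfying the strong triangle inequality $d(x,y)\le\max\{d(x,z),d(z,y)\}$ for all $x,y,z\in X$. A pseudoultrametric on $X$ is a symmetric function $d\colon X\times X\to\mathbb{R}^{+}$ with $d(x,x)=0$ for every $x\in X$ that satisfies the strong triangle inequality. A function $f\colon\mathbb{R}^{+}\to\mathbb{R}^{+}$ is pseudoultrametric preserving if $f\circ d$ is a pseudoultrametric on $X$ for every pseudoultrametric space $(X,d)$. For a metric space $(X,d)$, the distance set is $D(X)=D(X,d)=\{d(x,y)\colon x,y\in X\}$ and $\operatorname{diam}(X,d)=\sup D(X)$; the space is bounded if $\operatorname{diam}(X,d)<\infty$. For nonempty metric spaces $(Z,\delta)$ and $(X,d)$, a mapping $\Phi\colon Z\to X$ is a weak similarity of $(Z,\delta)$ and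 $(X,d)$ if $\Phi$ is bijective and there is a strictly increasing function $\psi\colon D(X)\to D(Z)$ such that $\delta(x,y)=\psi(d(\Phi(x),\Phi(y)))$ for all $x,y\in Z$. The function $\psi$ is uniquely determined by $\Phi$ and is called the scaling function of $\Phi$; the spaces are then called weakly similar. $WS(X,d)$ is the class of all ultrametric spaces weakly similar to $(X,d)$. $\mathbb{R}^{+}\setminus D(X)$ carries the subspace topology from $\mathbb{R}$; a component is a maximal connected subset. *)

(* Defs.v *)
From mathcomp Require Import all_boot all_order all_algebra.
From mathcomp Require Import all_classical all_reals all_analysis.
Set Implicit Arguments.
Unset Strict Implicit.
Unset Printing Implicit Defensive.
Import Order.TTheory GRing.Theory Num.Theory.
Import numFieldNormedType.Exports.
Local Open Scope classical_set_scope.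
Local Open Scope ring_scope.

(* Functions between subsets of [R] (such as [R+ -> R+] or [D(X) -> D(Z)]) are
   encoded as total functions [R -> R] whose values outside the domain are
   never used: [set_fun] (or nonnegativity) constrains the codomain, and
   equality and monotonicity are only required [{in domain, _}]. *)

Definition strong_triangle (R : realType) (Y : Type) (d : Y -> Y -> R) : Prop :=
  forall x y z, d x y <= Num.max (d x z) (d z y).

Definition ultrametric_space (R : realType) (X : metricType R) : Prop :=
  strong_triangle (@mdist R X).

Definition pseudoultrametric (R : realType) (Y : Type) (d : Y -> Y -> R) : Prop :=
  [/\ forall x y, 0 <= d x y,
      forall x, d x x = 0,
      forall x y, d x y = d y x
    & strong_triangle d].

Definition pseudoultrametric_preserving (R : realType) (f : R -> R) : Prop :=
  (forall t, 0 <= t -> 0 <= f t) /\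
  (forall (Y : Type) (d : Y -> Y -> R),
     pseudoultrametric d -> pseudoultrametric (fun x y => f (d x y))).

Definition distance_set (R : realType) (X : metricType R) : set R :=
  [set mdist x y | x in [set: X] & y in [set: X]].

(* The supremum is taken in [\bar R], so that it is [+oo] for unbounded
   spaces. *)
Definition diam (R : realType) (X : metricType R) : \bar R :=
  ereal_sup (EFin @` distance_set X).

Definition bounded_space (R : realType) (X : metricType R) : Prop :=
  (diam X < +oo)%E.

Definition weak_similarity (R : realType) (Z X : metricType R)
    (Phi : Z -> X) (psi : R -> R) : Prop :=
  [/\ bijective Phi,
      set_fun (distance_set X) (distance_set Z) psi,
      {in distance_set X &, {homo psi : s t / s < t}}
    & forall x y : Z, mdist x y = psi (mdist (Phi x) (Phi y))].

Definition weakly_similar (R : realType) (Z X : metricType R) : Prop :=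
  [/\ [set: Z] !=set0, [set: X] !=set0
    & exists (Phi : Z -> X) (psi : R -> R), weak_similarity Phi psi].

Definition WS (R : realType) (X Z : metricType R) : Prop :=
  ultrametric_space Z /\ weakly_similar Z X.

(* Connectedness of [C `<=` A] in the subspace topology of [A] is the same as
   connectedness of [C] in the ambient space. *)
Definition is_component (T : topologicalType) (A C : set T) : Prop :=
  [/\ C `<=` A, connected C
    & forall B, B `<=` A -> connected B -> C `<=` B -> B = C].

Lemma is_componentP (T : topologicalType) (A C : set T) : C !=set0 ->
  is_component A C <-> exists2 x, A x & connected_component A x = C.
Proof.
move=> [c Cc]; split=> [[CA Cconn Cmax]|[x Ax <-]].
  exists c; first exact: CA.
  apply: Cmax; first exact: connected_component_sub.
    exact: component_connected.
  exact: connected_component_max.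
split; [exact: connected_component_sub|exact: component_connected|].
move=> B BA Bconn CB; apply/seteqP; split=> //.
by apply: connected_component_max => //; apply: CB; exact: connected_component_refl.
Qed.

(* Main.v *)
Require Import Defs.
From HB Require Import structures.
From mathcomp Require Import all_boot all_order all_algebra.
From mathcomp Require Import all_classical all_reals all_analysis.
From mathcomp Require Import lra.
Import Order.TTheory GRing.Theory Num.Theory.
Import numFieldNormedType.Exports.
Local Open Scope classical_set_scope.
Local Open Scope ring_scope.

(* A pseudoultrametric preserving function is exactly a nondecreasing [g] with
   [g 0 = 0]. If [D(X)] has a supremum [a] that it does not attain, then
   rescaling [d] by [t / (a - t)] gives an unbounded ultrametric, whose scaling
   functions cannot be restrictions of such a [g], since [g <= g a] on [D(X)].
   Otherwise every section of [D(X)] by [[0, t]] is bounded by an element of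
   [D(X)], and any scaling function [psi] extends to the nondecreasing function
   [t |-> sup {psi s : s in D(X), s <= t}]. *)

Lemma max_homo {R : realType} (A : set R) (f : R -> R) (s t u : R) :
  (forall x y, A x -> A y -> x <= y -> f x <= f y) ->
  A s -> A t -> A u -> s <= Num.max t u -> f s <= Num.max (f t) (f u).
Proof.
by move=> fA As At Au; rewrite !le_max => /orP[st|su]; apply/orP;
  [left|right]; exact: fA.
Qed.

(** Test [g] on an isosceles triangle with base [s] and two legs [t], the apex being [None]. After
    composing with [g], the strong triangle inequality through the apex bounds the image of the base
    by that of a leg. *)
Lemma preserving_nondecreasing {R : realType} (g : R -> R) (s t : R) :
  pseudoultrametric_preserving g -> 0 <= s -> s <= t -> g s <= g t.
Proof.
move=> [_ gP] s0 st.
have t0 := le_trans s0 st.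
pose d (x y : option bool) : R :=
  if x == y then 0 else if (x != None) && (y != None) then s else t.
have dP : pseudoultrametric d.
  split.
  - by move=> [[]|] [[]|]; rewrite /d /=.
  - by move=> [[]|]; rewrite /d /=.
  - by move=> [[]|] [[]|]; rewrite /d /=.
  - by move=> [[]|] [[]|] [[]|]; rewrite /d /= le_max ?lexx ?s0 ?t0 ?st ?orbT.
have [_ _ _ /(_ (Some true) (Some false) None)] := gP _ _ dP.
by rewrite /d /= maxxx.
Qed.

Lemma nondecreasing_preserving {R : realType} (g : R -> R) : g 0 = 0 ->
  (forall s t, 0 <= s -> 0 <= t -> s <= t -> g s <= g t) ->
  pseudoultrametric_preserving g.
Proof.
move=> g0 gle; have gge0 t : 0 <= t -> 0 <= g t.
  by move=> t0; rewrite -g0 gle.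
split=> // Y d [d0 dxx dC dT]; split.
- by move=> x y; exact: gge0.
- by move=> x; rewrite dxx.
- by move=> x y; rewrite dC.
- by move=> x y z; apply: (@max_homo _ [set t | 0 <= t] g) => //=.
Qed.

(** The bound [m] of a section may exceed [t]: it only has to lie in [D], so that [psi m] bounds the
    values of [psi] on the section and the supremum defining the extension is finite. *)
Lemma extend_scaling {R : realType} (D : set R) (psi : R -> R) :
  D 0 -> (forall t, D t -> 0 <= t) ->
  psi 0 = 0 -> (forall s t, D s -> D t -> s <= t -> psi s <= psi t) ->
  (forall t, exists2 m, D m & forall s, D s -> s <= t -> s <= m) ->
  exists2 g, pseudoultrametric_preserving g & {in D, g =1 psi}.
Proof.
move=> D0 Dge0 psi0 psile Dm.
pose S t := psi @` (D `&` [set s | s <= t]).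
have supS t : 0 <= t -> has_sup (S t).
  move=> t0; split; first by exists (psi 0), 0.
  have [m mD mP] := Dm t; exists (psi m) => _ [s [Ds st] <-].
  by apply: psile => //; exact: mP.
have supE t : D t -> sup (S t) = psi t.
  move=> Dt; apply/eqP; rewrite eq_le; apply/andP; split.
    apply: ge_sup; first by exists (psi 0), 0 => //; split=> //; exact: Dge0.
    by move=> _ [s [Ds st] <-]; exact: psile.
  by apply: ub_le_sup; [case: (supS t (Dge0 _ Dt))|exists t => //; split=> /=].
exists (fun t => sup (S t)); last by move=> t /set_mem; exact: supE.
apply: nondecreasing_preserving; first by rewrite supE.
move=> s t s0 t0 st; apply: sup_le (supS _ s0).1 (supS _ t0) => _ [u [Du us] <-].
exists (psi u); split=> //; exists u => //; split=> //=; exact: le_trans us st.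
Qed.

(** Connected subsets of the line are intervals, so the ray can be enlarged inside the complement
    exactly when [D] leaves a gap just below [a]. *)
Lemma ray_component {R : realType} (D : set R) (a : R) : 0 < a ->
  is_component (`[0, +oo[%classic `\` D) `[a, +oo[%classic <->
  (forall t, D t -> t < a) /\
  (forall b, 0 <= b -> b < a -> exists2 t, D t & b < t).
Proof.
move=> a0; split=> [[sub _ cmax]|[Da Db]].
  have Da t : D t -> t < a.
    move=> Dt; rewrite ltNge; apply/negP => at_.
    by have [|_ +] := sub t; rewrite /= ?in_itv/= ?andbT.
  split=> // b b0 ba; apply: contrapT => noD.
  (* With no point of [D] above [b], this larger ray would also be admissible; the midpoint of [b]
     and [a] then contradicts maximality. *)
  have /seteqP[+ _] : `]b, +oo[%classic = `[a, +oo[%classic.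
    apply: cmax.
    - move=> x; rewrite /= !in_itv/= !andbT => bx; split.
        exact: le_trans (ltW bx).
      by move=> Dx; apply: noD; exists x.
    - by apply/connected_intervalP; exact: interval_is_interval.
    - by move=> x; rewrite /= !in_itv/= !andbT; exact: lt_le_trans.
  move=> /(_ ((b + a) / 2)); rewrite /= !in_itv/= !andbT => /(_ _) bad.
  by have : a <= (b + a) / 2 by [apply: bad; lra]; lra.
split.
- move=> x; rewrite /= !in_itv/= !andbT => ax; split.
    exact: le_trans (ltW a0) ax.
  by move=> /Da; rewrite ltNge ax.
- by apply/connected_intervalP; exact: interval_is_interval.
- move=> B BA /connected_intervalP Bi aB; apply/seteqP; split=> // x Bx.
  rewrite /= in_itv/= andbT leNgt; apply/negP => xa.
  have x0 : 0 <= x by have [] := BA _ Bx; rewrite /= in_itv/= andbT.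
  (* An interval containing both [x] and [a] must contain this point of [D], which [B] avoids. *)
  have [t Dt xt] := Db _ x0 xa.
  have Bt : B t.
    apply: (Bi x a) => //; last by rewrite (ltW xt) (ltW (Da _ Dt)).
    by apply: aB; rewrite /= in_itv/= lexx.
  by have [] := BA _ Bt.
Qed.

Lemma metricType_of_dist {R : realType} (T : choiceType) (d : T -> T -> R) :
  (forall x, d x x = 0) -> (forall x y, d x y = 0 -> x = y) ->
  (forall x y, d x y = d y x) -> (forall y x z, d x z <= d x y + d y z) ->
  exists (M : metricType R) (i : M -> T),
    bijective i /\ forall x y, mdist x y = d (i x) (i y).
Proof.
case: T d => T [cT eT] d dxx d0 dC dT.
(* [isMetric.Build] cannot infer the choice structure of an abstract type. *)
pose m := @isMetric.Axioms_ R T cT eT d dxx d0 dC dT.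
pose M : metricType R := HB.pack T cT eT m.
by exists M, id; split=> //; exists id.
Qed.

Lemma distance_set0 {R : realType} (X : metricType R) :
  [set: X] !=set0 -> distance_set X 0.
Proof. by move=> [x _]; exists x => //; exists x => //; exact: mdistxx. Qed.

Lemma distance_set_ge0 {R : realType} (X : metricType R) (t : R) :
  distance_set X t -> 0 <= t.
Proof. by move=> [x _ [y _ <-]]; exact: mdist_ge0. Qed.

Lemma distance_setE {R : realType} (X : metricType R) (x y : X) :
  distance_set X (mdist x y).
Proof. by exists x => //; exists y. Qed.

(** A nondecreasing [f] preserves the strong triangle inequality, and strictness keeps distinct
    points apart. The bijection from the rescaled copy back to [X] is a weak similarity with scaling
    function [f]. *)
Lemma rescale_ultrametric {R : realType} (X : metricType R) (f : R -> R) :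
  [set: X] !=set0 -> ultrametric_space X -> f 0 = 0 ->
  {in distance_set X &, {homo f : s t / s < t}} ->
  exists2 Z : metricType R, WS X Z & distance_set Z = f @` distance_set X.
Proof.
move=> X0 uX f0 finc.
have D0 := distance_set0 X X0.
have fle s t : distance_set X s -> distance_set X t -> s <= t -> f s <= f t.
  move=> Ds Dt; rewrite le_eqVlt => /predU1P[->//|st].
  by apply/ltW/finc => //; exact: mem_set.
have fge0 (x y : X) : 0 <= f (mdist x y).
  by rewrite -f0 fle ?mdist_ge0//; exact: distance_setE.
have fT (x y z : X) :
    f (mdist x y) <= Num.max (f (mdist x z)) (f (mdist z y)).
  by apply: (@max_homo _ (distance_set X)) => //; exact: distance_setE.
have [||||Z [i [ibij dZ]]] := @metricType_of_dist R X (fun x y => f (mdist x y)).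
- by move=> x; rewrite mdistxx.
- move=> x y fxy; apply: contrapT => /eqP; rewrite -mdist_gt0 => dxy.
  have := finc 0 (mdist x y) (mem_set D0) (mem_set (distance_setE _ x y)) dxy.
  by rewrite f0 fxy ltxx.
- by move=> x y; rewrite metric_sym.
- move=> y x z; apply: le_trans (fT x z y) _.
  by rewrite ge_max lerDl lerDr !fge0.
have [j ij ji] := ibij.
exists Z; last first.
  apply/seteqP; split=> [_ [x _ [y _ <-]]|_ [_ [x _ [y _ <-]] <-]].
    by rewrite dZ; exists (mdist (i x) (i y)) => //; exact: distance_setE.
  by rewrite -(ji x) -(ji y) -dZ; exact: distance_setE.
split; first by move=> x y z; rewrite !dZ; exact: fT.
split=> //; first by have [x _] := X0; exists (j x).
exists i, f; split=> //.
move=> _ [x _ [y _ <-]].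
by rewrite -(ji x) -(ji y) -dZ; exact: distance_setE.
Qed.

(** This puts the first condition as the failure of the hypothesis on sections in
    [extend_scaling]. *)
Lemma unattained_diamP {R : realType} (X : metricType R) :
  [set: X] !=set0 ->
  bounded_space X /\ ~ (EFin @` distance_set X) (diam X) <->
  ~ forall t, exists2 m, distance_set X m &
      forall s, distance_set X s -> s <= t -> s <= m.
Proof.
move=> X0; have D0 := distance_set0 X X0.
rewrite /bounded_space; split=> [[bX nX]|].
  have d0 : (0%:E <= diam X)%E by apply: ereal_sup_ubound; exists 0.
  (* The diameter is a real [r]. The section at [r] is all of [distance_set X], so a bound of it
     inside the set would attain [r]. *)
  move: d0 bX nX; case Ed: (diam X) => [r| |]// _ _ nX /(_ r)[m Dm mr].
  apply: nX; exists m => //; rewrite -Ed; apply/eqP; rewrite eq_le.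
  apply/andP; split; first by apply: ereal_sup_ubound; exists m.
  apply: ge_ereal_sup => _ [s Ds <-]; rewrite lee_fin; apply: mr => //.
  by rewrite -lee_fin -Ed; apply: ereal_sup_ubound; exists s.
move=> /existsNP[t /forall2NP nt].
(* A distance beyond [t] would itself bound the section at [t]. *)
have Dt s : distance_set X s -> s <= t.
  move=> Ds; have [//|ns] := nt s.
  rewrite leNgt; apply/negP => ts; apply: ns => u _ ut.
  exact: le_trans ut (ltW ts).
split.
  apply: (@le_lt_trans _ _ t%:E); last exact: ltry.
  by apply: ge_ereal_sup => _ [s Ds <-]; rewrite lee_fin Dt.
move=> [m Dm dm]; have [//|] := nt m; apply=> s Ds _.
by rewrite -lee_fin dm; apply: ereal_sup_ubound; exists s.
Qed.

Theorem theorem2p11 (R : realType) (X : metricType R)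
    (X0 : [set: X] !=set0) (uX : ultrametric_space X) :
  [<-> bounded_space X /\ ~ (EFin @` distance_set X) (diam X);
       exists2 a : R, 0 < a &
         is_component (`[0, +oo[%classic `\` distance_set X) `[a, +oo[%classic;
       exists2 Z : metricType R, WS X Z &
         forall (Phi : Z -> X) (psi : R -> R), weak_similarity Phi psi ->
         forall g : R -> R, pseudoultrametric_preserving g ->
           ~ {in distance_set X, g =1 psi}].
Proof.
have D0 := distance_set0 X X0.
tfae.
- move=> [bX nX].
  have ub s : distance_set X s -> (s%:E <= diam X)%E.
    by move=> Ds; apply: ereal_sup_ubound; exists s.
  move: (bX) (nX) (ub 0 D0) (ub); rewrite /bounded_space.
  case Ed: (diam X) => [a| |]// _ na _ Da.
  have {}Da s : distance_set X s -> s < a.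
    move=> Ds; rewrite lt_neqAle -lee_fin Da// andbT.
    by apply/eqP => sa; apply: na; exists s => //; rewrite sa.
  exists a; first exact: Da.
  apply/ray_component; first exact: Da.
  split=> // b b0 ba; apply: contrapT => nD.
  suff : (a%:E <= b%:E)%E by rewrite lee_fin leNgt ba.
  rewrite -Ed; apply: ge_ereal_sup => _ [s Ds <-]; rewrite lee_fin leNgt.
  by apply/negP => bs; apply: nD; exists s.
- move=> [a a0 /(ray_component _ _ a0)[Da Db]].
  pose f t := t / (a - t).
  have fD t : distance_set X t -> 0 < a - t by move=> /Da; rewrite subr_gt0.
  have finc : {in distance_set X &, {homo f : s t / s < t}}.
    move=> s t /set_mem Ds /set_mem Dt st.
    (* After cross-multiplication the terms [s * t] cancel, leaving [s * a < t * a]. *)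
    rewrite /f ltr_pdivrMr ?fD// mulrAC ltr_pdivlMr ?fD//.
    by rewrite !mulrBr (mulrC s t) ltrD2r ltr_pM2r.
  have [|Z ZX DZ] := rescale_ultrametric X f X0 uX _ finc.
    by rewrite /f mul0r.
  exists Z => // Phi psi [_ _ _ dPsi] g gP gpsi.
  (* Each distance in [Z] is a value of [psi], hence of [g], at a point below [a]. *)
  have DZub u : distance_set Z u -> u <= g a.
    move=> [x _ [y _ <-]]; rewrite dPsi -gpsi; last first.
      exact/mem_set/distance_setE.
    apply: preserving_nondecreasing => //; first exact: mdist_ge0.
    exact/ltW/Da/distance_setE.
  have ga0 : 0 <= g a by apply: gP.1; exact: ltW.
  (* [t / (a - t) > g a] as soon as [t > a * g a / (1 + g a)]. *)
  have g1 : 0 < 1 + g a by lra.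
  have [||t Dt bt] := Db (a * g a / (1 + g a)).
  - by rewrite divr_ge0// ?mulr_ge0// ltW.
  - by rewrite ltr_pdivrMr// ltr_pM2l//; lra.
  have : f t <= g a by apply: DZub; rewrite DZ; exists t.
  rewrite /f ler_pdivrMr ?fD//.
  move: bt; rewrite ltr_pdivrMr//; lra.
- move=> [Z [_ [[z _] _ [Phi [psi PhiP]]]] noext].
  (* If all sections are bounded inside [distance_set X], extending the scaling function of one weak
     similarity already contradicts [noext]. *)
  apply/unattained_diamP => // Dm.
  have [_ _ psinc dPsi] := PhiP.
  have [|||g gP] := extend_scaling (distance_set X) psi D0 _ _ _ Dm.
  - exact: distance_set_ge0.
  - by have := dPsi z z; rewrite !mdistxx.
  - move=> s t Ds Dt; rewrite le_eqVlt => /predU1P[->//|st].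
    by apply/ltW/psinc => //; exact: mem_set.
  exact: noext PhiP g gP.
Qed.
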